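(* Let $\hat\sigma$ be an isotropic Cauchy stress response and let $F\in\mathrm{GL}^+(3)$ be an idealized shear deformation such that $\hat\sigma(FF^T)$ is a non-trivial Cauchy pure shear stress, i.e. $\hat\sigma(FF^T)=s\,(e_1\otimes e_2+e_2\otimes e_1)$ with $s\in\mathbb{R}\setminus\{0\}$. Then $F$ is a left finite simple shear deformation, i.e. there exists $\alpha\in\mathbb{R}$ with $$F=\frac{1}{\sqrt{\cosh(2\alpha)}}\begin{pmatrix}1&\sinh(2\alpha)&0\\0&\cosh(2\alpha)&0\\0&0&\sqrt{\cosh(2\alpha)}\end{pmatrix}.$$
   Context: $e_1,e_2,e_3$ is the standard basis of $\mathbb{R}^3$. $\mathrm{GL}^+(3)$ denotes the real $3\times3$ matrices with positive determinant, $\mathrm{Sym}(3)$ the symmetric real $3\times 3$ matrices and $\mathrm{Sym}^+(3)$ the positive definite symmetric ones. An isotropic Cauchy stress response is a map $\hat\sigma:\mathrm{Sym}^+(3)\to\mathrm{Sym}(3)$ with $\hat\sigma(QBQ^T)=Q\hat\sigma(B)Q^T$ for all $Q\in\mathrm{SO}(3)$ and $B\in\mathrm{Sym}^+(3)$; the Cauchy stress corresponding to $F\in\mathrm{GL}^+(3)$ is $\hat\sigma(FF^T)$. A matrix $F=VR\in\mathrm{GL}^+(3)$ with $V\in\mathrm{Sym}^+(3)$ and $R\in\mathrm{SO}(3)$ (left polar decomposition) is called an idealized (finite) shear deformation if: (i) the stretch $V$ (or, equivalently, the deformation $F$) is volume preserving, i.e. $\det V=1$; (ii) the stretch $V$ is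 planar, i.e. $V$ has the eigenvalue $1$ to the eigenvector $e_3$; (iii) the rotation $R$ is such that $F$ is ground parallel, i.e. $e_1$ and $e_3$ are eigenvectors of $F$. In the theorem this is read as: $\det F=1$, $e_3$ is an eigenvector of $F$ for the eigenvalue $1$, and $e_1$ is an eigenvector of $F$.
   Formalization: It is additionally assumed that the eigenvalue of F for the eigenvector e_1 is positive; without this the claim fails for F·diag(-1,-1,1) with F a left finite simple shear, which has the same FF^T and the same stress. *)

(* Defs.v *)
From mathcomp Require Import all_boot all_order all_algebra.
From mathcomp Require Import reals topology normedtype sequences exp.

Set Implicit Arguments.
Unset Strict Implicit.
Unset Printing Implicit Defensive.

Import Order.TTheory GRing.Theory Num.Theory.
Local Open Scope ring_scope.

Section Shear.
Variable R : realType.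
Implicit Types (A B F Q : 'M[R]_3) (a : R).

Definition cosh a : R := (expR a + expR (- a)) / 2.
Definition sinh a : R := (expR a - expR (- a)) / 2.

Definition e1 : 'cV[R]_3 := delta_mx (inord 0) 0.
Definition e2 : 'cV[R]_3 := delta_mx (inord 1) 0.
Definition e3 : 'cV[R]_3 := delta_mx (inord 2) 0.

Definition tensor (u v : 'cV[R]_3) : 'M[R]_3 := u *m v^T.

Definition GLp F : Prop := 0 < \det F.
Definition Sym A : Prop := A^T = A.
Definition posdef A : Prop :=
  forall x : 'cV[R]_3, x != 0 -> 0 < (x^T *m A *m x) 0 0.
Definition Symp A : Prop := Sym A /\ posdef A.
Definition SO Q : Prop := Q *m Q^T = 1%:M /\ \det Q = 1.

(* A map Sym+(3) -> Sym(3) is represented by a total function on matrices, of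
   which only the values on Sym+(3) are constrained. *)
Definition isotropic_stress_response (sigma : 'M[R]_3 -> 'M[R]_3) : Prop :=
  (forall B, Symp B -> Sym (sigma B)) /\
  (forall Q B, SO Q -> Symp B ->
     sigma (Q *m B *m Q^T) = Q *m sigma B *m Q^T).

(* Matrices act on column vectors, whereas the library's [eigenvalue] is about
   row vectors. *)
Definition is_eigenvector A (v : 'cV[R]_3) a : Prop :=
  v != 0 /\ A *m v = a *: v.

Definition idealized_shear F : Prop :=
  [/\ \det F = 1,
      is_eigenvector F e3 1
    & exists lambda : R, is_eigenvector F e1 lambda].

(* Not implied by [idealized_shear]: F and F diag(-1,-1,1) have the same F F^T,
   hence the same Cauchy stress, and either both or neither is an idealized
   shear; only the sign of the eigenvalue for e1 tells them apart. *)
Definition ground_orientation_preserving F : Prop :=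
  forall lambda : R, is_eigenvector F e1 lambda -> 0 < lambda.

Definition pure_shear_stress (s : R) : 'M[R]_3 :=
  s *: (tensor e1 e2 + tensor e2 e1).

Definition nontrivial_pure_shear_stress A : Prop :=
  exists2 s : R, s != 0 & A = pure_shear_stress s.

Definition mx3 (rows : seq (seq R)) : 'M[R]_3 :=
  \matrix_(i < 3, j < 3) nth 0 (nth [::] rows i) j.

Definition left_finite_simple_shear_mx a : 'M[R]_3 :=
  (Num.sqrt (cosh (2 * a)))^-1 *:
    mx3 [:: [:: 1; sinh (2 * a); 0];
            [:: 0; cosh (2 * a); 0];
            [:: 0; 0; Num.sqrt (cosh (2 * a))]].

Definition left_finite_simple_shear F : Prop :=
  exists alpha : R, F = left_finite_simple_shear_mx alpha.

End Shear.

(* Main.v *)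
(** An eigenvector v of a symmetric B is an eigenvector of every isotropic
    response sigma(B): the reflection along v commutes with B, hence with
    sigma(B); in odd dimension its determinant -1 is harmless, since a reflection
    and its negative act on B in the same way.  A pure shear stress has the simple
    eigenvalues 0, s, -s, so every eigenvector of B = F F^T is parallel to e3,
    e1 + e2 or e1 - e2.  A real eigenvector of B exists because the dimension is
    odd.  If it is e1 + e2 or e1 - e2, then B_11 = B_22, and F_32 = 0 since
    otherwise F_11 = 0; if it is e3, then F_32 = 0, and B_11 = B_22 because
    an eigenvector of the upper left block of B is again e1 + e2 or e1 - e2.
    With b = F_12 and c = F_22 = 1 / F_11, the equation B_11 = B_22 reads
    1 / c^2 + b^2 = c^2, i.e. cosh(2 alpha) = c^2 when sinh(2 alpha) = b c. *)

Require Import Defs.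
From mathcomp Require Import all_boot all_order all_algebra.
From mathcomp Require Import reals.
From mathcomp Require Import exp polyrcf ring lra.
Import Order.TTheory GRing.Theory Num.Theory.
Local Open Scope ring_scope.

(** * Real eigenvectors and reflections *)

Lemma odd_dim_eigenvector (R : rcfType) (n : nat) (A : 'M[R]_n) : odd n ->
  exists (v : 'cV[R]_n) (a : R), v != 0 /\ A *m v = a *: v.
Proof.
move=> n_odd; have [|a] := @odd_poly_root _ (char_poly A^T).
  by rewrite size_char_poly /= n_odd.
rewrite -eigenvalue_root_char => /eigenvalueP [v vA v0]; exists v^T, a; split.
  by rewrite -trmx0 (inj_eq trmx_inj).
by rewrite -[A]trmxK -trmx_mul vA linearZ.
Qed.

Lemma dot_gt0 (R : realFieldType) (n : nat) (v : 'cV[R]_n) :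
  v != 0 -> 0 < (v^T *m v) 0 0.
Proof.
move=> v0; have sqE : (v^T *m v) 0 0 = \sum_i v i 0 ^+ 2.
  by rewrite mxE; apply: eq_bigr => i _; rewrite mxE expr2.
rewrite sqE lt_neqAle sumr_ge0 ?andbT => [|i _]; last exact: sqr_ge0.
apply: contra v0; rewrite eq_sym psumr_eq0 => [/allP v0|i _]; last exact: sqr_ge0.
apply/eqP/matrixP => i j; rewrite ord1 mxE.
by apply/eqP; rewrite -sqrf_eq0; apply: v0; rewrite mem_index_enum.
Qed.

Definition reflection (R : fieldType) (n : nat) (v : 'cV[R]_n) : 'M[R]_n :=
  1%:M - (2 / (v^T *m v) 0 0) *: (v *m v^T).

Lemma reflection_tr (R : fieldType) (n : nat) (v : 'cV[R]_n) :
  (reflection R n v)^T = reflection R n v.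
Proof. by rewrite /reflection linearB linearZ /= trmx1 trmx_mul trmxK. Qed.

Lemma reflectionK (R : realFieldType) (n : nat) (v : 'cV[R]_n) :
  v != 0 -> reflection R n v *m reflection R n v = 1%:M.
Proof.
move=> v0; have := dot_gt0 R n v v0; rewrite /reflection.
have := mx11_scalar (v^T *m v).
move: ((v^T *m v) 0 0) => d vTv d_gt0.
have vv : v *m v^T *m (v *m v^T) = d *: (v *m v^T).
  rewrite -mulmxA [v^T *m (v *m _)]mulmxA vTv.
  by rewrite mul_scalar_mx -scalemxAr.
rewrite mulmxBl mul1mx mulmxBr mulmx1 -scalemxAl -scalemxAr vv !scalerA.
have -> : 2 / d * (2 / d) * d = 2 / d + 2 / d by field; rewrite gt_eqF.
by rewrite scalerDl opprB addrK addrNK.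
Qed.

Lemma reflection_comm_symmetric (R : realFieldType) (n : nat) (v : 'cV[R]_n)
    (A : 'M[R]_n) (a : R) :
  A^T = A -> A *m v = a *: v -> reflection R n v *m A = A *m reflection R n v.
Proof.
move=> symA Av; have vA : v^T *m A = a *: v^T by rewrite -{1}symA -trmx_mul Av linearZ.
rewrite /reflection mulmxBl mulmxBr mulmx1 mul1mx -scalemxAl -scalemxAr.
by rewrite -mulmxA vA mulmxA Av -scalemxAr -scalemxAl.
Qed.

(** Commuting with the reflection amounts to commuting with v v^T. Applied to v, this gives (v^T A
    v) v = (v^T v) A v, so the eigenvalue is the Rayleigh quotient. *)
Lemma eigenvector_of_reflection_comm (R : realFieldType) (n : nat)
    (v : 'cV[R]_n) (A : 'M[R]_n) :
  v != 0 -> reflection R n v *m A = A *m reflection R n v ->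
  exists a, A *m v = a *: v.
Proof.
move=> v0; have := dot_gt0 R n v v0; rewrite /reflection.
have := mx11_scalar (v^T *m v).
move: ((v^T *m v) 0 0) => d vTv d_gt0.
rewrite mulmxBl mulmxBr mulmx1 mul1mx -scalemxAl -scalemxAr.
move=> /addrI /oppr_inj /(scalerI _) vvA.
have {}vvA : v *m v^T *m A = A *m (v *m v^T).
  by apply: vvA; rewrite mulf_neq0 ?invr_eq0 ?gt_eqF ?ltr0n.
exists (d^-1 * (v^T *m A *m v) 0 0).
have vvAv : (v^T *m A *m v) 0 0 *: v = d *: (A *m v).
  rewrite -mul_mx_scalar -mx11_scalar !mulmxA vvA -mulmxA -mulmxA vTv.
  by rewrite mul_mx_scalar scalemxAr.
by rewrite -scalerA vvAv scalerA mulVf ?gt_eqF // scale1r.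
Qed.

(** * Isotropic responses under the full orthogonal group *)

Lemma isotropic_orthogonal (R : realType) (sigma : 'M[R]_3 -> 'M[R]_3)
    (Q B : 'M[R]_3) :
  isotropic_stress_response sigma -> Q *m Q^T = 1%:M -> Symp B ->
  sigma (Q *m B *m Q^T) = Q *m sigma B *m Q^T.
Proof.
move=> [_ iso] QQ sB.
have : \det Q ^+ 2 = 1 by rewrite expr2 -{2}det_tr -det_mulmx QQ det1.
move/eqP; rewrite sqrf_eq1 => /orP [] /eqP dQ; first exact: iso.
have /iso - /(_ B sB) : SO (- Q).
  rewrite /SO linearN mulNmx mulmxN opprK QQ; split=> //.
  by rewrite -scaleN1r detZ dQ -signr_odd expr1 mulrNN mulr1.
by rewrite linearN !mulNmx !mulmxN !opprK.
Qed.

Lemma isotropic_eigenvector (R : realType) (sigma : 'M[R]_3 -> 'M[R]_3)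
    (B : 'M[R]_3) (v : 'cV[R]_3) (a : R) :
  isotropic_stress_response sigma -> Symp B -> is_eigenvector B v a ->
  exists t, is_eigenvector (sigma B) v t.
Proof.
move=> iso sB [v0 Bv]; set H := reflection R 3 v.
have HH : H *m H = 1%:M by exact: reflectionK.
have HT : H^T = H by exact: reflection_tr.
have HB : H *m B = B *m H by apply: reflection_comm_symmetric Bv; case: sB.
have := isotropic_orthogonal R sigma H B iso; rewrite HT => /(_ HH sB).
(* Since H B H = B, isotropy turns into [sigma B] = H [sigma B] H. *)
rewrite HB -mulmxA HH mulmx1 => sH.
have [|t tP] := eigenvector_of_reflection_comm R 3 v (sigma B) v0.
  by rewrite -/H {2}sH -!mulmxA HH mulmx1.
by exists t.
Qed.

Lemma Symp_mul_tr (R : realType) (F : 'M[R]_3) :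
  \det F != 0 -> Symp (F *m F^T).
Proof.
move=> dF; split; first by rewrite /Sym trmx_mul trmxK.
move=> x x0; rewrite mulmxA -mulmxA -[x^T *m F]trmxK trmx_mul trmxK.
apply: dot_gt0; apply: contra x0 => /eqP Fx.
have uF : F^T \in unitmx by rewrite unitmxE det_tr unitfE.
by rewrite -[x](mulKmx uF) Fx mulmx0.
Qed.

(** The witness is arsinh x = ln (x + r); the inverse of x + r is r - x because r^2 - x^2 = 1. *)
Lemma sinh_surj (R : realType) (x : R) :
  exists a, sinh a = x /\ cosh a = Num.sqrt (x ^+ 2 + 1).
Proof.
set r := Num.sqrt (x ^+ 2 + 1).
have r2 : r ^+ 2 = x ^+ 2 + 1 by rewrite sqr_sqrtr // addr_ge0 ?sqr_ge0.
have r_gt : `|x| < r.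
  by rewrite -sqrtr_sqr ltr_sqrt ?ltrDl // ltr_wpDl ?sqr_ge0.
have y_gt0 : 0 < x + r by move: r_gt; rewrite ltr_norml => /andP [] *; lra.
have yV : (x + r)^-1 = r - x.
  by apply: (mulfI (lt0r_neq0 y_gt0)); rewrite mulfV ?gt_eqF //; ring: r2.
by exists (ln (x + r)); rewrite /sinh /cosh expRN lnK // yV; split; field.
Qed.

(** * Coordinates in dimension three *)

Lemma mx3_entries (R : realType) (F : 'M[R]_3) :
  F = mx3 [:: [:: F (inord 0) (inord 0); F (inord 0) (inord 1); F (inord 0) (inord 2)];
              [:: F (inord 1) (inord 0); F (inord 1) (inord 1); F (inord 1) (inord 2)];
              [:: F (inord 2) (inord 0); F (inord 2) (inord 1); F (inord 2) (inord 2)]].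
Proof.
apply/matrixP => i j; rewrite mxE.
by rewrite -[in LHS](inord_val i) -[in LHS](inord_val j);
   case: i j => [[|[|[|?]]] ?] [[|[|[|?]]] ?].
Qed.

Lemma det_mx3 (R : realType) (a11 a12 a13 a21 a22 a23 a31 a32 a33 : R) :
  \det (mx3 [:: [:: a11; a12; a13]; [:: a21; a22; a23]; [:: a31; a32; a33]]) =
  a11 * (a22 * a33 - a23 * a32) - a12 * (a21 * a33 - a23 * a31)
    + a13 * (a21 * a32 - a22 * a31).
Proof.
rewrite (expand_det_row _ ord0) !big_ord_recl big_ord0 /cofactor.
rewrite !(expand_det_row _ ord0) !big_ord_recl !big_ord0 /cofactor !det_mx11.
by rewrite !mxE /= !(exprS, expr0); ring.
Qed.

Lemma mul_mx3_col (R : realType) (A : 'M[R]_3) (v : 'cV[R]_3) (i : 'I_3) :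
  (A *m v) i 0 = A i (inord 0) * v (inord 0) 0 + A i (inord 1) * v (inord 1) 0
                 + A i (inord 2) * v (inord 2) 0.
Proof.
rewrite mxE !big_ord_recl big_ord0 addr0 addrA.
by do !congr (_ + _); congr (A i _ * v _ 0); apply/val_inj; rewrite /= inordK.
Qed.

Lemma pure_shear_stressE (R : realType) (s : R) :
  pure_shear_stress s = mx3 [:: [:: 0; s; 0]; [:: s; 0; 0]; [:: 0; 0; 0]].
Proof.
rewrite /pure_shear_stress /tensor /e1 /e2 !trmx_delta !mul_delta_mx.
apply/matrixP => i j; rewrite !mxE -!val_eqE /= !inordK //.
by case: i j => [[|[|[|?]]] ?] [[|[|[|?]]] ?] //=;
   rewrite ?(addr0, add0r, mulr0, mulr1).
Qed.

(** The rows read s y = t x, s x = t y and 0 = t z. If t = 0, then x = y = 0; otherwise z = 0 and s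
    x^2 = t x y = s y^2. *)
Lemma pure_shear_eigenvector (R : realType) (s t : R) (v : 'cV[R]_3) :
  s != 0 -> pure_shear_stress s *m v = t *: v ->
  v (inord 0) 0 = 0 /\ v (inord 1) 0 = 0 \/
  v (inord 2) 0 = 0 /\ v (inord 0) 0 ^+ 2 = v (inord 1) 0 ^+ 2.
Proof.
move=> s0 /matrixP Tv.
have := Tv (inord 2) 0; have := Tv (inord 1) 0; have := Tv (inord 0) 0.
rewrite !mul_mx3_col pure_shear_stressE !mxE !inordK //=.
set x := v _ _; set y := v _ _; set z := v _ _.
rewrite !(mul0r, addr0, add0r) => sy sx /esym/eqP; rewrite mulf_eq0.
case/orP=> /eqP z0; [left | right].
  move: sy sx; rewrite z0 !mul0r => /eqP + /eqP.
  by rewrite !mulf_eq0 (negbTE s0) /= => /eqP -> /eqP ->.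
split=> //; apply: (mulfI s0).
have -> : s * x ^+ 2 = x * (s * x) by ring.
have -> : s * y ^+ 2 = y * (s * y) by ring.
by rewrite sx sy; ring.
Qed.

Lemma vec3_neq0 (R : realType) (v : 'cV[R]_3) :
  (v != 0) = ~~ [&& v (inord 0) 0 == 0, v (inord 1) 0 == 0 & v (inord 2) 0 == 0].
Proof.
congr (~~ _); apply/eqP/and3P => [->|[/eqP v0 /eqP v1 /eqP v2]].
  by rewrite !mxE.
by apply/matrixP => i j; rewrite ord1 mxE -[i]inord_val; case: i => [[|[|[|?]]] ?].
Qed.

(** The general matrix with eigenvectors e1, for the eigenvalue l, and e3, for the eigenvalue 1:
    only the second column is free. *)
Definition ground_parallel_mx (R : realType) (l b c d : R) : 'M[R]_3 :=
  mx3 [:: [:: l; b; 0]; [:: 0; c; 0]; [:: 0; d; 1]].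

Lemma left_Cauchy_Green_eigenP (R : realType) (l b c d t : R) (v : 'cV[R]_3) :
  let F := ground_parallel_mx R l b c d in
  let x := v (inord 0) 0 in let y := v (inord 1) 0 in let z := v (inord 2) 0 in
  F *m F^T *m v = t *: v <->
  [/\ (l ^+ 2 + b ^+ 2) * x + b * c * y + b * d * z = t * x,
      b * c * x + c ^+ 2 * y + c * d * z = t * y
    & b * d * x + c * d * y + (d ^+ 2 + 1) * z = t * z].
Proof.
move=> F x y z.
have [E0 E1 E2] : let w := F *m F^T *m v in
    [/\ w (inord 0) 0 = (l ^+ 2 + b ^+ 2) * x + b * c * y + b * d * z,
        w (inord 1) 0 = b * c * x + c ^+ 2 * y + c * d * z
      & w (inord 2) 0 = b * d * x + c * d * y + (d ^+ 2 + 1) * z].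
  rewrite /= -mulmxA !mul_mx3_col -/x -/y -/z !mxE !inordK //=.
  by split; ring.
rewrite -E0 -E1 -E2; split=> [->|[w0 w1 w2]]; first by rewrite !mxE.
apply/matrixP => i j; rewrite ord1 -[i]inord_val.
by case: i => [[|[|[|?]]] ?] //=; rewrite [RHS]mxE.
Qed.

(** The stress enters only through the second hypothesis: eigenvectors of B are parallel to e3, e1 +
    e2 or e1 - e2. *)
Lemma ground_parallel_coeffs (R : realType) (l b c d : R)
    (B := ground_parallel_mx R l b c d *m (ground_parallel_mx R l b c d)^T) :
  l * c = 1 ->
  (forall v t, is_eigenvector B v t ->
     v (inord 0) 0 = 0 /\ v (inord 1) 0 = 0 \/
     v (inord 2) 0 = 0 /\ v (inord 0) 0 ^+ 2 = v (inord 1) 0 ^+ 2) ->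
  d = 0 /\ l ^+ 2 + b ^+ 2 = c ^+ 2.
Proof.
move=> lc eigB.
have c0 : c != 0 by apply: contra_eq_neq lc => ->; rewrite mulr0 eq_sym oner_eq0.
have l0 : l != 0 by apply: contra_eq_neq lc => ->; rewrite mul0r eq_sym oner_eq0.
have [//|v [t [v0 Bv]]] := odd_dim_eigenvector R 3 B.
have [] := iffLR (left_Cauchy_Green_eigenP R l b c d t v) Bv.
move: (v0) (eigB v t (conj v0 Bv)); rewrite vec3_neq0.
move: (v (inord 0) 0) (v (inord 1) 0) (v (inord 2) 0) => x y z.
move=> xyz0 [[x0 y0]|[z0 xy]] eqx eqy eqz; last first.
  have y0 : y != 0.
    by move: xyz0; rewrite z0 eqxx andbT -(sqrf_eq0 x) xy sqrf_eq0 andbb.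
  move: eqx eqy eqz; rewrite z0 !mulr0 !addr0 => eqx eqy eqz.
  have lbc : l ^+ 2 + b ^+ 2 = c ^+ 2.
    apply: (mulIf (_ : y ^+ 2 != 0)); first by rewrite sqrf_eq0.
    rewrite -{1}xy.
    (* Multiplied by x and y, the first two equations share the term b c x y; their difference is
       (l^2 + b^2) x^2 - c^2 y^2 = t (x^2 - y^2) = 0. *)
    have := congr1 ( *%R x) eqx; have := congr1 ( *%R y) eqy.
    have := congr1 ( *%R t) xy; lra.
  split=> //; apply/eqP; apply: contraT => d0.
  (* The third equation is d (b x + c y) = 0. *)
  have bx : b * x = - (c * y) by apply: (mulfI d0); lra.
  have : l ^+ 2 * y ^+ 2 = 0.
    have : (b * x) ^+ 2 = (c * y) ^+ 2 by rewrite bx sqrrN.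
    by rewrite !exprMn xy -lbc; lra.
  by move/eqP; rewrite mulf_eq0 !sqrf_eq0 (negbTE l0) (negbTE y0).
(* Now v is parallel to e3, and the second equation reduces to c d z = 0. *)
rewrite x0 y0 !eqxx /= in xyz0; move: eqy; rewrite x0 y0 !mulr0 !add0r.
move=> /eqP; rewrite !mulf_eq0 (negbTE c0) (negbTE xyz0) orbF /= => /eqP d0.
split=> //.
(* As d = 0, an eigenvector (p, q) of the upper left block extends by 0 to one of B. *)
have eig_plane (p q mu : R) : (p != 0) || (q != 0) ->
    (l ^+ 2 + b ^+ 2) * p + b * c * q = mu * p -> b * c * p + c ^+ 2 * q = mu * q ->
    p ^+ 2 = q ^+ 2.
  move=> pq0 eq1 eq2; pose w : 'cV[R]_3 := \col_i nth 0 [:: p; q; 0] i.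
  have [w0 w1 w2] : [/\ w (inord 0) 0 = p, w (inord 1) 0 = q & w (inord 2) 0 = 0].
    by rewrite !mxE !inordK.
  have := eigB w mu; rewrite w0 w1 w2.
  case=> [|[-> ->]|[]] //; split; first by rewrite vec3_neq0 w0 w1 w2 eqxx andbT negb_and.
  by apply/left_Cauchy_Green_eigenP; rewrite w0 w1 w2 d0 !(mulr0, mul0r, addr0).
(* If b = 0, then e1 would be an eigenvector of B, which the hypothesis excludes. *)
have b0 : b != 0.
  apply/eqP => b0; have := eig_plane 1 0 (l ^+ 2).
  rewrite b0 oner_eq0 => /(_ isT) e; have /eqP := e ltac:(ring) ltac:(ring).
  by rewrite expr0n expr1n oner_eq0.
set p := l ^+ 2 + b ^+ 2 in eig_plane *.
(* the eigenvalue mu of the upper left block has the eigenvector (b c, mu - p) *)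
pose D := (p - c ^+ 2) ^+ 2 + 4 * (b * c) ^+ 2.
have rD : Num.sqrt D ^+ 2 = D.
  by rewrite sqr_sqrtr // addr_ge0 ?sqr_ge0 // mulr_ge0 ?sqr_ge0.
pose mu := (p + c ^+ 2 + Num.sqrt D) / 2.
have muE : (mu - p) * (mu - c ^+ 2) = (b * c) ^+ 2.
  have -> : (mu - p) * (mu - c ^+ 2) = (Num.sqrt D ^+ 2 - (p - c ^+ 2) ^+ 2) / 4.
    by rewrite /mu; field.
  by rewrite rD /D; field.
have bc0 : b * c != 0 by rewrite mulf_neq0.
(* Compared with the characteristic equation [muE], this gives mu - c^2 = mu - p after division by
   mu - p, hence p = c^2. *)
have sq : (b * c) ^+ 2 = (mu - p) ^+ 2.
  apply: (eig_plane _ _ mu); first by rewrite bc0.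
    by ring.
  by move: muE; lra.
have mup : mu - p != 0 by rewrite -sqrf_eq0 -sq sqrf_eq0.
have : mu - c ^+ 2 = mu - p by apply: (mulfI mup); rewrite muE sq.
by move/addrI/oppr_inj.
Qed.

Theorem theorem3p7 (R : realType) (sigma : 'M[R]_3 -> 'M[R]_3) (F : 'M[R]_3)
    (hsigma : isotropic_stress_response sigma)
    (hF : GLp F)
    (hshear : idealized_shear F)
    (horient : ground_orientation_preserving F)
    (hstress : nontrivial_pure_shear_stress (sigma (F *m F^T))) :
  left_finite_simple_shear F.
Proof.
have [detF [_ Fe3] [l Fe1]] := hshear; have l_gt0 := horient _ Fe1.
case: hstress => s s0 sE; case: Fe1 => _ Fe1.
have FE : F = ground_parallel_mx R l (F (inord 0) (inord 1))
    (F (inord 1) (inord 1)) (F (inord 2) (inord 1)).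
  have col0 i : F i (inord 0) = (l *: e1 R) i 0 by rewrite -Fe1 /e1 -colE mxE.
  have col2 i : F i (inord 2) = (1 *: e3 R) i 0 by rewrite -Fe3 /e3 -colE mxE.
  rewrite {1}[F]mx3_entries !col0 !col2 !mxE -!val_eqE /= !inordK //=.
  by rewrite !(mulr0, mulr1).
move: (F (inord 0) _) (F (inord 1) _) (F (inord 2) _) FE => b c d FE.
have lc : l * c = 1 by rewrite -detF FE det_mx3; ring.
have [v t eigv|d0 lbc] := ground_parallel_coeffs R l b c d lc.
  have sB : Symp (F *m F^T) by apply: Symp_mul_tr; rewrite detF oner_eq0.
  rewrite -FE in eigv.
  have [u [_]] := isotropic_eigenvector R sigma _ v t hsigma sB eigv.
  by rewrite sE; exact: pure_shear_eigenvector.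
(* The orientation hypothesis selects the root c = sqrt (c^2) below. *)
have c_gt0 : 0 < c by rewrite -(pmulr_rgt0 _ l_gt0) lc.
have [a [sinh_a cosh_a]] := sinh_surj R (b * c).
have cosh_c : cosh a = c ^+ 2.
  (* By l c = 1, b^2 c^2 + 1 = (b^2 + l^2) c^2 = c^4. *)
  rewrite cosh_a; have -> : (b * c) ^+ 2 + 1 = (c ^+ 2) ^+ 2.
    by rewrite [RHS]expr2 -{1}lbc -(expr1n _ 2) -lc; ring.
  by rewrite sqrtr_sqr ger0_norm // sqr_ge0.
have lE : l = c^-1 by apply: (mulIf (lt0r_neq0 c_gt0)); rewrite lc mulVf ?gt_eqF.
exists (a / 2); rewrite /left_finite_simple_shear_mx.
have -> : 2 * (a / 2) = a by field.
rewrite cosh_c sinh_a sqrtr_sqr gtr0_norm // FE lE d0.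
apply/matrixP => i j; rewrite !mxE.
case: i j => [[|[|[|?]]] ?] [[|[|[|?]]] ?] //=; field; exact: lt0r_neq0.
Qed.
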